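(* For each integer $n\ge 2$ let $X_1=X_1^{(n)},\dots,X_n=X_n^{(n)}$ be independent real random variables with distribution functions $F_{n,1},\dots,F_{n,n}$, such that $\bar F_n=n^{-1}\sum_{i=1}^n F_{n,i}$ is continuous. Suppose that for every $n\ge 2$ there is a partition $\mathcal I_{n,1},\dots,\mathcal I_{n,g}$ (with $g=g(n)$) of $\{1,\dots,n\}$ such that each $\mathcal I_{n,j}$ contains at least 2 indices and $F_{n,i}=F_{n,i'}$ for all $i,i'\in\mathcal I_{n,j}$. Then for every $\tau\in(0,1)$ such that $nV_n(\tau)=\sum_{i=1}^n F_{n,i}(\bar Q_n(\tau))[1-F_{n,i}(\bar Q_n(\tau))]\to\infty$ as $n\to\infty$, $$\left(\frac{n}{\widehat V(\tau)}\right)^{1/2}\bigl(\widehat F(\bar Q_n(\tau))-\tau\bigr)\xrightarrow{d}\mathcal N(0,1)\qquad (n\to\infty),$$ where $\xrightarrow{d}$ denotes convergence in distribution and $\mathcal N(0,1)$ is the standard normal distribution. (On the event $\widehat V(\tau)=0$ the left-hand side may be assigned an arbitrary value.)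
   Context: The quantile function of a distribution function $F$ is its left-continuous inverse $p\mapsto\inf\{x\in\mathbb R: F(x)\ge p\}$. $\bar Q_n$ denotes the quantile function of $\bar F_n$. The empirical distribution function is $\widehat F(x)=n^{-1}\sum_{i=1}^n \mathbf 1\{X_i\le x\}$, and $\widehat Q$ denotes its quantile function (the empirical quantile function). The heterogeneous variance is $V_n(\tau)=n^{-1}\sum_{i=1}^n F_{n,i}(\bar Q_n(\tau))[1-F_{n,i}(\bar Q_n(\tau))]$. With $m_j$ the cardinality of $\mathcal I_{n,j}$ (so $n=m_1+\cdots+m_g$), the variance estimator is $$\widehat V(\tau)=n^{-1}\sum_{j=1}^{g}\frac{1}{m_j-1}\sum_{\ell_1,\ell_2\in\mathcal I_{n,j}}\mathbf 1\{X_{\ell_1}\le\widehat Q(\tau),\,X_{\ell_2}>\widehat Q(\tau)\}.$$ The partition, $g$ and $m_j$ may all depend on $n$. *)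

(* Defs.v *)
From mathcomp Require Import all_boot all_order all_algebra.
From mathcomp Require Import all_classical all_reals all_analysis.

Set Implicit Arguments.
Unset Strict Implicit.
Unset Printing Implicit Defensive.

Import Order.TTheory GRing.Theory Num.Theory.
Import numFieldNormedType.Exports.

Local Open Scope classical_set_scope.
Local Open Scope ring_scope.

Definition independent_RVs d (T : measurableType d) (R : realType)
    (P : probability T R) (I : finType) (X : I -> {RV P >-> R}) : Prop :=
  forall (J : {set I}) (B : I -> set R), (forall i, measurable (B i)) ->
    P (\bigcap_(i in [set` J]) X i @^-1` B i) =
    (\prod_(i in J) P (X i @^-1` B i))%E.

(* Convergence of the distribution functions at every continuity point of the
   limit; the variables may live on different probability spaces. *)
Definition cvg_in_distribution (d : nat -> measure_display)
    (T : forall n, measurableType (d n)) (R : realType)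
    (P : forall n, probability (T n) R) (Y : forall n, {RV (P n) >-> R})
    (mu : probability (measurableTypeR R) R) : Prop :=
  forall x : R, {for x, continuous (fun t : R => mu `]-oo, t]%classic)} ->
    cdf (Y n) x @[n --> \oo] --> mu `]-oo, x]%classic.

(* The library's [cdf] takes values in [\bar R]; it is always finite. *)
Definition dist_fun d (T : measurableType d) (R : realType)
    (P : probability T R) (X : {RV P >-> R}) (x : R) : R := fine (cdf X x).

Section Quantiles.
Variable R : realType.

Definition quantile (F : R -> R) (p : R) : R := inf [set x | p <= F x].

Variable n : nat.

Definition mean_df (F : 'I_n -> R -> R) (x : R) : R :=
  n%:R^-1 * \sum_(i < n) F i x.

Definition mean_quantile (F : 'I_n -> R -> R) (tau : R) : R :=
  quantile (mean_df F) tau.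

Definition het_var (F : 'I_n -> R -> R) (tau : R) : R :=
  n%:R^-1 * \sum_(i < n)
    F i (mean_quantile F tau) * (1 - F i (mean_quantile F tau)).

Definition emp_df (x : 'I_n -> R) (t : R) : R :=
  n%:R^-1 * \sum_(i < n) (x i <= t)%R%:R.

Definition emp_quantile (x : 'I_n -> R) (tau : R) : R :=
  quantile (emp_df x) tau.

Definition var_est (Pi : {set {set 'I_n}}) (x : 'I_n -> R) (tau : R) : R :=
  n%:R^-1 * \sum_(A in Pi) (#|A|%:R - 1)^-1 *
    \sum_(l1 in A) \sum_(l2 in A)
      ((x l1 <= emp_quantile x tau) && (emp_quantile x tau < x l2))%R%:R.

End Quantiles.

(* Main.v *)
From HB Require Import structures.
Require Import Defs.
From mathcomp Require Import all_boot all_order all_algebra.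
From mathcomp Require Import all_classical all_reals all_analysis.
From mathcomp Require Import ring lra.

Set Implicit Arguments.
Unset Strict Implicit.
Unset Printing Implicit Defensive.

Import Order.TTheory GRing.Theory Num.Theory.
Import numFieldNormedType.Exports.

Local Open Scope classical_set_scope.
Local Open Scope ring_scope.

(** Fix [n] and put [q = mean_quantile (F n) tau], [p i = F n i q], so that
    [sum_i p i = n tau], and let [v = sum_i p i (1 - p i)] be [n] times the
    heterogeneous variance. With [N] the number of observations below [q] and
    [w] the variance estimator, the studentized statistic equals
    [(N - n tau) / sqrt (n w)]. It is therefore enough to show that
    [(N - n tau) / sqrt v] is asymptotically standard normal and that
    [n w / v] tends to [1] in probability, as [v] tends to infinity. Both
    facts involve the observations only through the indicators
    [X i <= t] for at most three thresholds [t]; for one threshold these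
    indicators have a product of Bernoulli laws (prob_below), so that every
    estimate takes place on the finite set of configurations
    [{ffun I -> bool}].

    Normality is proved by the method of Stein. The test functions are
    [x |-> max (z - x) 0]: the Stein equation
    [G x = x g x + max (z - x) 0 - E (max (z - Z) 0)], with [Z] standard
    normal and [G] the derivative of [g], is solved explicitly by the Mills
    ratio, and the classical bounds on that ratio make [G] Lipschitz
    (stein_solution). For a sum of independent centred Bernoulli variables
    divided by [s = sqrt v], exchanging one coordinate gives the exact
    formula stein_identity, hence an error [C / s] in the Stein equation
    (stein_bernoulli). As the derivative in [z] of [E (max (z - Z) 0)] is the
    normal distribution function, difference quotients in [z] turn this into
    two-sided bounds on distribution functions (bernoulli_sum_clt).

    For the variance, write [U t] for [n] times the estimator with the
    threshold [t] in the place of the empirical quantile; it is a sum over the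
    blocks of [K (m - K) / (m - 1)], with [K] the number of observations of
    the block below [t]. Because the law is constant on a block, the mean of
    [U q] is exactly [v]. Changing one indicator changes [U] by at most [1],
    so the Efron-Stein inequality bounds the variance of [U q] by [v], which
    is negligible before [v ^ 2]. The same Lipschitz property compares [U] at
    the empirical quantile with [U q]: choose [qm < q < qp] at
    which the mean of the counts is [n tau - delta v] and [n tau + delta v].
    By Chebyshev the two counts are within [delta v] of their means with high
    probability; then the empirical quantile lies between [qm] and [qp], and
    the two values of [U] differ by at most the number of observations between
    [qm] and [qp], hence by at most [4 delta v] (var_est_close). Ties between
    the observations never have to be excluded. *)

(** * Products of Bernoulli laws *)

Section BernoulliProduct.
Variables (R : realType) (I : finType) (p : I -> R).
Hypothesis p01 : forall i, 0 <= p i <= 1.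
Implicit Types (f g : {ffun I -> bool} -> R) (b c : {ffun I -> bool}) (i : I).

(** The product of the Bernoulli laws of parameters [p i], as a weight on
    configurations; [bexp] and [bprob] are its expectation and its
    probabilities. *)
Definition bweight b : R := \prod_i (if b i then p i else 1 - p i).

Definition bexp f : R := \sum_b bweight b * f b.

Definition bprob (E : pred {ffun I -> bool}) : R := bexp (fun b => (E b)%:R).

Definition bset i (x : bool) b : {ffun I -> bool} :=
  [ffun j => if j == i then x else b j].

(** The conditional expectation of [f] given all coordinates but [i]. *)
Definition bavg i f b : R :=
  p i * f (bset i true b) + (1 - p i) * f (bset i false b).

(** The discrete derivative of [f] in the direction [i]. *)
Definition bosc i f b : R := f (bset i true b) - f (bset i false b).

Definition bflip i b : {ffun I -> bool} :=
  [ffun j => if j == i then ~~ b j else b j].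

Lemma bweight_ge0 b : 0 <= bweight b.
Proof.
apply: prodr_ge0 => i _; have /andP[p0 p1] := p01 i.
by case: (b i) => //; rewrite subr_ge0.
Qed.

Lemma bexpD f g : bexp (fun b => f b + g b) = bexp f + bexp g.
Proof. by rewrite /bexp -big_split; apply: eq_bigr => b _; rewrite mulrDr. Qed.

Lemma bexpZ (k : R) f : bexp (fun b => k * f b) = k * bexp f.
Proof. by rewrite /bexp big_distrr; apply: eq_bigr => b _; rewrite mulrCA. Qed.

Lemma bexpB f g : bexp (fun b => f b - g b) = bexp f - bexp g.
Proof.
rewrite /bexp -sumrB; apply: eq_bigr => b _; by rewrite mulrBr.
Qed.

Lemma bexp_sum (J : finType) (A : pred J) (f : J -> {ffun I -> bool} -> R) :
  bexp (fun b => \sum_(j | A j) f j b) = \sum_(j | A j) bexp (f j).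
Proof.
rewrite /bexp exchange_big; apply: eq_bigr => b _.
by rewrite big_distrr.
Qed.

Lemma eq_bexp f g : f =1 g -> bexp f = bexp g.
Proof. by move=> fg; apply: eq_bigr => b _; rewrite fg. Qed.

Lemma le_bexp f g : (forall b, f b <= g b) -> bexp f <= bexp g.
Proof.
by move=> fg; apply: ler_sum => b _; rewrite ler_wpM2l ?bweight_ge0.
Qed.

Lemma bexp1 : bexp (fun=> 1) = 1.
Proof.
rewrite /bexp; under eq_bigr do rewrite mulr1 /bweight.
rewrite -(bigA_distr_bigA (fun i x => if x then p i else 1 - p i)).
by apply: big1 => i _; rewrite big_bool /= addrC subrK.
Qed.

Lemma bexp_cst (k : R) : bexp (fun=> k) = k.
Proof.
by rewrite (eq_bexp (g := fun=> k * 1)) ?bexpZ ?bexp1 ?mulr1// => b; rewrite mulr1.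
Qed.

Lemma bflipK i : involutive (bflip i).
Proof. by move=> b; apply/ffunP => j; rewrite !ffunE; case: eqP => // _; rewrite negbK. Qed.

Lemma bset_flip i x b : bset i x (bflip i b) = bset i x b.
Proof. by apply/ffunP => j; rewrite !ffunE; case: eqP. Qed.

Lemma bset_set i x y b : bset i x (bset i y b) = bset i x b.
Proof. by apply/ffunP => j; rewrite !ffunE; case: eqP. Qed.

Lemma bset_setC i j x y b : i != j ->
  bset i x (bset j y b) = bset j y (bset i x b).
Proof.
move=> ij; apply/ffunP => k; rewrite !ffunE.
by case: (eqVneq k i) => [->|//]; rewrite (negbTE ij).
Qed.

Lemma bset_id i b : bset i (b i) b = b.
Proof. by apply/ffunP => j; rewrite !ffunE; case: eqP => [->|]. Qed.

Lemma bset_neg i b : bset i (~~ b i) b = bflip i b.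
Proof. by apply/ffunP => j; rewrite !ffunE; case: eqP => [->|]. Qed.

(** Averaging over one coordinate preserves the mean: exchanging [b i] and
    [~~ b i] changes the sign of [bweight b * (bavg i f b - f b)], so these
    terms cancel in pairs. *)
Lemma bexp_avg i f : bexp (bavg i f) = bexp f.
Proof.
apply/eqP; rewrite -subr_eq0 -bexpB; apply/eqP.
set D := fun b => bweight b * (bavg i f b - f b).
rewrite -[LHS]/(\sum_b D b).
have Dflip b : D (bflip i b) = - D b.
  rewrite /D /bavg !bset_flip /bweight (bigD1 i) //= [in RHS](bigD1 i) //=.
  rewrite [in LHS](eq_bigr (fun j => if b j then p j else 1 - p j)); last first.
    by move=> j /negbTE ji; rewrite ffunE ji.
  rewrite ffunE eqxx -bset_neg; move: (\prod_(j | j != i) _) => W.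
  by have := bset_id i b; case: (b i) => /= <-; rewrite ?bset_set; ring.
suff : \sum_b D b = - \sum_b D b by move=> h; lra.
rewrite [LHS](reindex_inj (inv_inj (bflipK i))) /= -sumrN.
by apply: eq_bigr => b _; rewrite Dflip.
Qed.

(** Move from [b] to [c] by correcting one disagreeing coordinate at a time. *)
Lemma bosc_lipschitz (K : I -> R) f :
  (forall i b, `|bosc i f b| <= K i) ->
  forall b c, `|f b - f c| <= \sum_i K i * (b i != c i)%:R.
Proof.
move=> fK b c.
have K0 i : 0 <= K i by apply: le_trans (fK i b).
have [m] := ubnP #|[pred i | b i != c i]|; elim: m => // m IHm in b *.
have [bc _|] := eqVneq b c.
  by rewrite bc subrr normr0 sumr_ge0// => i _; rewrite mulr_ge0.
move=> /eqP bc; have [i bci] : exists i, b i != c i.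
  apply/existsP; apply: contra_notT bc => /existsPn bc.
  by apply/ffunP => i; apply/eqP; have := bc i; rewrite negbK.
rewrite ltnS => card_bc.
have step : `|f b - f (bset i (c i) b)| <= K i.
  have := fK i b; rewrite /bosc -{3}(bset_id i b).
  move: bci; case: (b i); case: (c i) => //= _.
  by rewrite distrC.
rewrite (bigD1 i) //= bci mulr1 -(subrKA (f (bset i (c i) b))).
apply: le_trans (ler_normD _ _) (lerD step _).
apply: le_trans (IHm _ _) _.
  apply: leq_trans card_bc; apply: proper_card; apply/properP; split.
    apply/fintype.subsetP => j; rewrite !inE ffunE; case: (eqVneq j i) => [->|//].
    by rewrite eqxx.
  by exists i; rewrite !inE ?ffunE ?eqxx.
rewrite (bigD1 i) //= ffunE !eqxx mulr0 add0r; apply: ler_sum => j ji.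
by rewrite ffunE (negbTE ji).
Qed.

Lemma bosc_avg i j (k : R) f : (forall b, `|bosc j f b| <= k) ->
  forall b, `|bosc j (bavg i f) b| <= if j == i then 0 else k.
Proof.
move=> fk b; rewrite /bosc /bavg; have [->|ji] := eqVneq j i.
  by rewrite !bset_set subrr normr0.
rewrite !(bset_setC (i := i)) 1?eq_sym //.
have /andP[p0 p1] := p01 i.
rewrite (_ : _ - _ = p i * bosc j f (bset i true b) +
    (1 - p i) * bosc j f (bset i false b)); last by rewrite /bosc; ring.
apply: le_trans (ler_normD _ _) _.
rewrite !normrM (ger0_norm p0) (ger0_norm (_ : 0 <= 1 - p i)) ?subr_ge0//.
have -> : k = p i * k + (1 - p i) * k by ring.
by rewrite lerD// ler_wpM2l// subr_ge0.
Qed.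

(** The Efron-Stein inequality. Averaging over the coordinate [i] lowers the
    second moment of [f] by the mean of [p i (1 - p i) (bosc i f) ^ 2],
    and, by bosc_avg, it kills the oscillation in the direction [i] without
    increasing the others. Once all coordinates are averaged out, the function
    is constant. The induction is on the number of nonzero bounds [K i]. *)
Lemma efron_stein (K : I -> R) f :
  (forall i b, `|bosc i f b| <= K i) ->
  bexp (fun b => f b ^+ 2) - bexp f ^+ 2 <= \sum_i p i * (1 - p i) * K i ^+ 2.
Proof.
have [m] := ubnP #|[pred i | K i != 0]|; elim: m => // m IHm in K f *.
rewrite ltnS => cardK fK.
have [/existsP[i Ki]|/existsPn K0] := boolP [exists i, K i != 0]; last first.
  have cst b c : f b = f c.
    apply/eqP; rewrite -subr_eq0 -normr_eq0 eq_le normr_ge0 andbT.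
    apply: le_trans (bosc_lipschitz fK b c) _.
    by rewrite big1// => i _; have := K0 i; rewrite negbK => /eqP->; rewrite mul0r.
  pose b0 : {ffun I -> bool} := [ffun=> true].
  rewrite (eq_bexp (g := fun=> f b0 ^+ 2)); last by move=> b; rewrite (cst b b0).
  rewrite [X in _ - X ^+ 2](eq_bexp (g := fun=> f b0)); last by move=> b; exact: cst.
  rewrite !bexp_cst subrr sumr_ge0// => i _.
  by have /andP[? ?] := p01 i; rewrite mulr_ge0 ?sqr_ge0// mulr_ge0 ?subr_ge0.
pose K' j := if j == i then 0 else K j.
have := IHm K' (bavg i f).
have -> : \sum_j p j * (1 - p j) * K' j ^+ 2 =
    \sum_j p j * (1 - p j) * K j ^+ 2 - p i * (1 - p i) * K i ^+ 2.
  rewrite (bigD1 i)//= [in RHS](bigD1 i)//= /K' eqxx expr0n mulr0 add0r [RHS]addrC addKr.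
  by apply: eq_bigr => j /negbTE->.
rewrite bexp_avg => IH.
have : bexp (fun b => f b ^+ 2) - bexp (fun b => bavg i f b ^+ 2) <=
    p i * (1 - p i) * K i ^+ 2.
  rewrite -(bexp_avg i (fun b => f b ^+ 2)) -bexpB.
  rewrite -[leRHS]bexp_cst; apply: le_bexp => b.
  rewrite (_ : _ - _ = p i * (1 - p i) * bosc i f b ^+ 2); last first.
    by rewrite /bavg /bosc; ring.
  have /andP[p0 p1] := p01 i.
  rewrite ler_wpM2l ?mulr_ge0 ?subr_ge0//.
  by rewrite -(real_normK (num_real (bosc i f b))) lerXn2r ?nnegrE// (le_trans _ (fK i b)).
suff : bexp (fun b => bavg i f b ^+ 2) - bexp f ^+ 2 <= 
    \sum_j p j * (1 - p j) * K j ^+ 2 - p i * (1 - p i) * K i ^+ 2 by lra.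
apply: IH.
  apply: leq_trans cardK; apply: proper_card; apply/properP; split.
    by apply/fintype.subsetP => j; rewrite !inE /K'; case: ifP; rewrite ?eqxx.
  by exists i; rewrite !inE /K' ?eqxx.
by move=> j b; apply: bosc_avg.
Qed.

Lemma bprob_chebyshev (K : I -> R) f (t : R) : 0 < t ->
  (forall i b, `|bosc i f b| <= K i) ->
  bprob (fun b => t <= `|f b - bexp f|) <=
  (\sum_i p i * (1 - p i) * K i ^+ 2) / t ^+ 2.
Proof.
move=> t0 fK; rewrite ler_pdivlMr ?exprn_gt0//.
apply: le_trans (efron_stein fK).
rewrite mulrC -bexpZ.
have -> : bexp (fun b => f b ^+ 2) - bexp f ^+ 2 =
    bexp (fun b => (f b - bexp f) ^+ 2).
  rewrite [RHS](eq_bexp (g := fun b => (f b ^+ 2 - 2 * bexp f * f b) + bexp f ^+ 2)).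
    by rewrite bexpD bexpB bexpZ bexp_cst; ring.
  by move=> b /=; ring.
apply: le_bexp => b; case: (boolP (t <= _)) => [tb|_]; last by rewrite mulr0 sqr_ge0.
by rewrite mulr1 -[leRHS]real_normK ?num_real// lerXn2r// nnegrE// ltW.
Qed.

Definition bcount b : R := \sum_i (b i)%:R.

Lemma bosc_count i b : bosc i bcount b = 1.
Proof.
have off x : \sum_(j | j != i) (bset i x b j)%:R = \sum_(j | j != i) (b j)%:R :> R.
  by apply: eq_bigr => j /negbTE ji; rewrite ffunE ji.
rewrite /bosc /bcount (bigD1 i)//= [X in _ - X](bigD1 i)//= !off !ffunE eqxx.
by rewrite /=; ring.
Qed.

Lemma bexp_coord i : bexp (fun b => (b i)%:R) = p i.
Proof.
rewrite -(bexp_avg i) -[RHS]bexp_cst; apply: eq_bexp => b.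
by rewrite /bavg !ffunE eqxx /=; ring.
Qed.

Lemma bexp_count : bexp bcount = \sum_i p i.
Proof. by rewrite bexp_sum; apply: eq_bigr => i _; rewrite bexp_coord. Qed.

Lemma bexp_coord2 i j : i != j ->
  bexp (fun b => (b i && ~~ b j)%:R) = p i * (1 - p j).
Proof.
move=> ij.
rewrite -(bexp_avg j) -(bexp_coord i) mulrC -bexpZ; apply: eq_bexp => b.
by rewrite /bavg !ffunE eqxx (negbTE ij); case: (b i) => /=; ring.
Qed.

Definition bvar : R := \sum_i p i * (1 - p i).

Definition bstd (s : R) b : R := (bcount b - bexp bcount) / s.

(** Write [S] for [bstd s]. Given the other coordinates, [b i - p i] takes the value [1 - p i] with
    probability [p i] and [- p i] with probability [1 - p i]; averaging over
    the coordinate [i] thus turns its product with [g (S b)] into the increment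
    of [g (S b)] between the two values of [b i]. *)
Lemma stein_identity (s : R) (g : R -> R) : 0 < s ->
  bexp (fun b => bstd s b * g (bstd s b)) =
  \sum_i p i * (1 - p i) / s *
    bexp (fun b => g (bstd s (bset i true b)) - g (bstd s (bset i false b))).
Proof.
move=> s0; set S := bstd s.
rewrite (eq_bexp (g := fun b => \sum_i s^-1 * (((b i)%:R - p i) * g (S b)))).
  rewrite bexp_sum; apply: eq_bigr => i _.
  rewrite bexpZ -(bexp_avg i) -!bexpZ; apply: eq_bexp => b.
  by rewrite /bavg !ffunE eqxx /=; ring.
move=> b; rewrite -mulr_sumr -mulr_suml {1}/S /bstd mulrAC mulrC bexp_count /bcount.
by rewrite sumrB.
Qed.

(** The two values of [S] in stein_identity differ by [s^-1] and one of them is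
    the actual value of [S], so a Taylor bound for [g] with derivative [G]
    replaces the increment by [G (S b) / s] up to [C / s ^ 2]; the weights
    [p i (1 - p i) / s ^ 2] add up to [1]. *)
Lemma stein_bernoulli (s C : R) (g G : R -> R) : 0 < s -> s ^+ 2 = bvar ->
  (forall x y w, x <= w <= y -> `|g y - g x - (y - x) * G w| <= C * (y - x) ^+ 2) ->
  `|bexp (fun b => G (bstd s b) - bstd s b * g (bstd s b))| <= C / s.
Proof.
move=> s0 s2 gG; set S := bstd s.
have Sstep i b : S (bset i true b) = S (bset i false b) + s^-1.
  have := bosc_count i b; rewrite /bosc => /eqP; rewrite subr_eq => /eqP e.
  by rewrite /S /bstd e; ring.
rewrite bexpB (stein_identity g s0) -/S.
have -> : bexp (fun b => G (S b)) =
    \sum_i p i * (1 - p i) / s ^+ 2 * bexp (fun b => G (S b)).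
  by rewrite -!mulr_suml -/bvar -s2 divff ?mul1r// expf_neq0// gt_eqF.
rewrite -sumrB.
have -> : C / s = \sum_i p i * (1 - p i) / s ^+ 2 * (C / s).
  by rewrite -!mulr_suml -/bvar -s2 divff ?mul1r// expf_neq0// gt_eqF.
apply: le_trans (ler_norm_sum _ _ _) _; apply: ler_sum => i _.
have -> : p i * (1 - p i) / s ^+ 2 * bexp (fun b => G (S b)) -
   p i * (1 - p i) / s * bexp (fun b => g (S (bset i true b)) - g (S (bset i false b)))
   = p i * (1 - p i) / s ^+ 2 * bexp (fun b => - s *
   (g (S (bset i true b)) - g (S (bset i false b)) - s^-1 * G (S b))).
  rewrite !(bexpZ, bexpB); field; exact: lt0r_neq0.
have /andP[p0 p1] := p01 i.
have v0 : 0 <= p i * (1 - p i) / s ^+ 2 by rewrite divr_ge0 ?sqr_ge0// mulr_ge0 ?subr_ge0.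
rewrite normrM (ger0_norm v0) ler_wpM2l//.
have H b : `|- s * (g (S (bset i true b)) - g (S (bset i false b)) - s^-1 * G (S b))| <= C / s.
  rewrite normrM normrN (gtr0_norm s0).
  have -> : C / s = s * (C * s^-1 ^+ 2) by field; exact: lt0r_neq0.
  rewrite ler_pM2l//.
  have sV0 : 0 < s^-1 by rewrite invr_gt0.
  have := gG (S (bset i false b)) (S (bset i true b)) (S b).
  have -> : S (bset i true b) - S (bset i false b) = s^-1.
    by rewrite Sstep addrC addKr.
  apply.
  rewrite Sstep.
  have [->| ->] : S b = S (bset i false b) + s^-1 \/ S b = S (bset i false b).
    rewrite -Sstep; have := bset_id i b.
    by case: (b i) => e; [left|right]; rewrite e.
    by rewrite lerDl ltW/=.
  by rewrite lexx lerDl ltW.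
rewrite ler_norml; apply/andP; split.
  rewrite -[leLHS]bexp_cst; apply: le_bexp => b.
  by have := H b; rewrite ler_norml => /andP[].
rewrite -[leRHS]bexp_cst; apply: le_bexp => b.
by have := H b; rewrite ler_norml => /andP[].
Qed.

End BernoulliProduct.

(** * The standard normal law and the Stein equation *)

Section StandardNormal.
Variable R : realType.
Implicit Types x y z w : R.

Local Notation phi := (normal_pdf (0 : R) 1).

Definition gauss_cdf x : R := fine (normal_prob (0 : R) 1 `]-oo, x]).

Lemma gauss_cdfE x : (gauss_cdf x)%:E = normal_prob (0 : R) 1 `]-oo, x].
Proof. by rewrite /gauss_cdf fineK// fin_num_measure. Qed.

Lemma gauss_cdf_ge0 x : 0 <= gauss_cdf x.
Proof. by rewrite -lee_fin gauss_cdfE. Qed.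

Lemma pdf_gt0 x : 0 < phi x.
Proof. by rewrite normal_pdfE ?oner_neq0// mulr_gt0 ?expR_gt0// normal_peak_gt0// oner_neq0. Qed.

Lemma pdfN x : phi (- x) = phi x.
Proof. by rewrite normal_pdfE ?oner_neq0// /normal_fun !subr0 sqrrN. Qed.

Lemma is_derive_pdf x : is_derive x 1 phi (- x * phi x).
Proof.
rewrite normal_pdfE ?oner_neq0// /normal_fun.
rewrite [X in is_derive _ _ X _](_ : _ =
   (normal_peak 1 *: (@expR R \o (fun y => (- 2^-1) *: (y ^+ 2))))); last first.
  apply/funext => y /=; rewrite /GRing.scale/= subr0 expr1n; congr (_ * expR _).
  by field.
apply: is_derive_eq.
rewrite /GRing.scale/= subr0 expr1n.
rewrite (_ : - x ^+ 2 / 2%:R = - 2^-1 * x ^+ 2); last by field.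
by field.
Qed.

Lemma is_derive_gauss_cdf x : is_derive x 1 gauss_cdf (phi x).
Proof.
have xx1 : x < x + 1 by rewrite ltrDl.
have iphi : (@lebesgue_measure R).-integrable [set` Interval -oo%O (BRight (x + 1))]
    (EFin \o phi).
  by apply: integrableS (integrable_normal_pdf 0 1).
have [dF <-] := continuous_FTC1 xx1 iphi (ltNyr _)
  (@continuous_normal_pdf R 0 1 (oner_neq0 R) x).
rewrite derive1E; exact: (DeriveDef dF).
Qed.

Let idTR : measurableTypeR R -> R := idfun.

HB.instance Definition _ :=
  @isMeasurableFun.Build _ _ _ _ idTR (@measurable_id _ _ setT).

Lemma cvg_gauss_cdfy : gauss_cdf x @[x --> +oo] --> (1 : R).
Proof. exact: (fine_cvg (cvg_cdfy1 (idTR : {RV normal_prob (0 : R) 1 >-> R}))). Qed.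

Lemma cvg_gauss_cdfNy : gauss_cdf x @[x --> -oo] --> (0 : R).
Proof. exact: (fine_cvg (cvg_cdfNy0 (idTR : {RV normal_prob (0 : R) 1 >-> R}))). Qed.

Lemma mean_value (f df : R -> R) x y : x <= y ->
  (forall t, x <= t <= y -> is_derive t 1 f (df t)) ->
  exists2 c, x <= c <= y & f y - f x = df c * (y - x).
Proof.
move=> xy fdf; have [|| c] := @MVT_segment R f df x y xy.
- by move=> t; rewrite in_itv/= => /andP[xt ty]; apply: fdf; rewrite !ltW.
- apply: derivable_within_continuous => t; rewrite in_itv/= => xty.
  by have [] := fdf t xty.
- by rewrite in_itv/=; exists c.
Qed.

Lemma is_derive_gauss_cdfN x : is_derive x 1 (gauss_cdf \o -%R) (- phi x).
Proof.
have := is_derive_gauss_cdf (- x); rewrite pdfN => d1.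
have := @is_derive1_comp R gauss_cdf -%R x _ _ d1 (is_deriveNid x 1).
by rewrite mulrN1.
Qed.

(** Both sides have the derivative [- phi] and tend to [0] at infinity. *)
Lemma gauss_cdf_sym x : gauss_cdf (- x) = 1 - gauss_cdf x.
Proof.
pose D : R -> R := cst 1 - gauss_cdf - (gauss_cdf \o -%R).
have D' y : is_derive y 1 D 0.
  have d1 := is_derive_gauss_cdf y; have d2 := is_derive_gauss_cdfN y.
  by apply: is_derive_eq; ring.
have Dcvg : D y @[y --> +oo] --> (1 - 1 - 0 : R).
  apply: cvgB; first by apply: cvgB; [exact: cvg_cst|exact: cvg_gauss_cdfy].
  by rewrite -(cvgNy_compNP gauss_cdf); exact: cvg_gauss_cdfNy.
have : D y @[y --> +oo] --> D x.
  rewrite (_ : D = cst (D x)); first exact: cvg_cst.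
  by apply/funext => y; exact: is_derive_0_is_cst.
move=> /(cvg_unique (@Rhausdorff R) Dcvg).
by rewrite subrr subr0 => /esym/eqP; rewrite subr_eq0 => /eqP.
Qed.

(** The Mills ratio: [gauss_cdf (- x)] is the upper tail at [x]. *)
Definition mills x : R := gauss_cdf (- x) / phi x.

Lemma mills_ge0 x : 0 <= mills x.
Proof. by rewrite divr_ge0 ?gauss_cdf_ge0// ltW// pdf_gt0. Qed.

Lemma is_derive_mills x : is_derive x 1 mills (x * mills x - 1).
Proof.
have d1 := is_derive_gauss_cdfN x.
have d2 := is_deriveV (lt0r_neq0 (pdf_gt0 x)) (is_derive_pdf x).
rewrite [X in is_derive _ _ X _](_ : _ =
  (gauss_cdf \o -%R) * (fun y => (phi y)^-1))//.
apply: is_derive_eq.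
rewrite /GRing.scale/= /mills; field.
exact: lt0r_neq0 (pdf_gt0 x).
Qed.

Lemma gauss_tail_small x e : 0 < e -> exists2 y, x <= y & gauss_cdf (- y) < e.
Proof.
move=> e0.
have /cvgr_lt/(_ _ e0) : gauss_cdf (- y) @[y --> +oo] --> (0 : R).
  by rewrite -(cvgNy_compNP gauss_cdf); exact: cvg_gauss_cdfNy.
case=> M [_ MP]; exists (Num.max x (M + 1)); first by rewrite le_max lexx.
by apply: MP; rewrite lt_max ltrDl ltr01 orbT.
Qed.

(** For [0 < x] the function [y |-> gauss_cdf (- y) - phi y / y] is
    nondecreasing on the right of [x] and bounded by a tail that tends to [0],
    so it cannot be positive at [x]. *)
Lemma mills_upper x : x * mills x <= 1.
Proof.
have [x0|x0] := leP x 0.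
  by apply: le_trans ler01; rewrite mulr_le0_ge0 ?mills_ge0.
rewrite leNgt; apply/negP => xM.
pose k y := gauss_cdf (- y) - phi y / y.
have k' y : x <= y -> is_derive y 1 k (phi y / y ^+ 2).
  move=> xy; have y0 : y != 0 by rewrite gt_eqF// (lt_le_trans x0).
  have d1 := is_derive_gauss_cdfN y; have d2 := is_derive_pdf y.
  have d3 := is_deriveV (y0 : id y != 0) (is_derive_id y 1).
  rewrite [X in is_derive _ _ X _](_ : _ =
    (gauss_cdf \o -%R) - phi * (fun y => (id y)^-1))//.
  apply: is_derive_eq.
  by rewrite /GRing.scale/=; field.
have kx : 0 < k x.
  rewrite subr_gt0 ltr_pdivrMr//; have := xM.
  by rewrite /mills mulrA ltr_pdivlMr ?pdf_gt0// mul1r mulrC.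
have [y xy Ty] := gauss_tail_small x kx.
have [|c /andP[xc cy] e] := mean_value (f := k) (df := fun y => phi y / y ^+ 2) xy.
  by move=> t /andP[xt _]; exact: k'.
have : k x <= k y.
  rewrite -subr_ge0 e mulr_ge0 ?subr_ge0// divr_ge0 ?sqr_ge0// ltW//.
  exact: pdf_gt0.
rewrite leNgt => /negP; apply; apply: le_lt_trans Ty.
by rewrite gerBl divr_ge0 ?(ltW (pdf_gt0 y))// (le_trans (ltW x0)).
Qed.

(** The function [y |-> gauss_cdf (- y) - y phi y / (1 + y ^ 2)] is
    nonincreasing; were it negative at [x], then [y phi y / (1 + y ^ 2)] would
    stay away from [0] as [y] grows. *)
Lemma mills_lower x : x <= (1 + x ^+ 2) * mills x.
Proof.
have sq y : 0 < 1 + y ^+ 2 by rewrite ltr_pwDl// sqr_ge0.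
rewrite leNgt; apply/negP => xM.
pose k y := gauss_cdf (- y) - y * phi y / (1 + y ^+ 2).
have k' y : is_derive y 1 k (- (2 * phi y / (1 + y ^+ 2) ^+ 2)).
  have d1 := is_derive_gauss_cdfN y; have d2 := is_derive_pdf y.
  have y0 : (cst 1 + (fun y => y ^+ 2)) y != 0 :> R by apply: lt0r_neq0; exact: sq.
  have d0 : is_derive y 1 (cst 1 + (fun y : R => y ^+ 2)) (2 * y).
    by apply: is_derive_eq; rewrite /GRing.scale/=; ring.
  have d3 := is_deriveV y0 d0.
  rewrite [X in is_derive _ _ X _](_ : _ =
    (gauss_cdf \o -%R) - (id * phi) * (fun y => ((cst 1 + (fun y => y ^+ 2)) y)^-1))//.
  apply: is_derive_eq.
  rewrite /GRing.scale/= !fctE; field; exact: lt0r_neq0 (sq y).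
pose e := - k x.
have e0 : 0 < e.
  rewrite oppr_gt0 subr_lt0 ltr_pdivlMr//.
  by have := xM; rewrite /mills mulrA ltr_pdivrMr ?pdf_gt0// mulrC.
(* Beyond this [y], the density being at most its peak value, the correction
   term is at most [e / 2]. *)
pose y := Num.max (Num.max x 1) (2 * normal_peak (1 : R) / e).
have peak0 : 0 < normal_peak (1 : R) by rewrite normal_peak_gt0 ?oner_neq0.
have xy : x <= y by rewrite !le_max lexx.
have y1 : 1 <= y by rewrite !le_max lexx orbT.
have ye : 2 * normal_peak (1 : R) / e <= y by rewrite !le_max lexx orbT.
have [c /andP[xc cy] ke] := mean_value (f := k) xy (fun t _ => k' t).
have : k y <= k x.
  rewrite -subr_le0 ke mulr_le0_ge0 ?subr_ge0//.
  by rewrite oppr_le0 divr_ge0 ?sqr_ge0// mulr_ge0// ltW// pdf_gt0.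
have y0 : 0 < y by apply: lt_le_trans y1.
have : y * phi y / (1 + y ^+ 2) <= e / 2.
  rewrite ler_pdivrMr//.
  apply: (@le_trans _ _ (y * normal_peak 1)).
    by rewrite ler_pM2l// normal_pdf_ub// oner_neq0.
  move: ye; rewrite ler_pdivrMr// => ye.
  have : y * (2 * normal_peak 1) <= y * (y * e) by rewrite ler_pM2l.
  by nra.
have := gauss_cdf_ge0 (- y); rewrite /k -/(k x).
by rewrite -[k x]opprK -/e; lra.
Qed.

Lemma mills_nonincreasing x y : x <= y -> mills y <= mills x.
Proof.
move=> xy; have [c _ e] := mean_value xy (fun t _ => is_derive_mills t).
by rewrite -subr_le0 e mulr_le0_ge0 ?subr_ge0// subr_le0 mills_upper.
Qed.

Lemma is_derive_mills' x :
  is_derive x 1 (fun y => y * mills y - 1) ((1 + x ^+ 2) * mills x - x).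
Proof.
have d1 := is_derive_mills x.
rewrite [X in is_derive _ _ X _](_ : _ = id * mills - cst 1)//.
by apply: is_derive_eq; rewrite /GRing.scale/=; ring.
Qed.

(** The derivative [x mills x - 1] of the Mills ratio is Lipschitz on every
    right half-line: its own derivative [(1 + x ^ 2) mills x - x] is
    nonnegative by mills_lower, at most [1 / x] for positive [x] by
    mills_upper, and bounded on bounded sets. This is the smoothness that the
    method of Stein requires. *)
Lemma mills_taylor z : exists2 B, 0 <= B & forall x w y, z <= x -> x <= w <= y ->
  `|mills y - mills x - (y - x) * (w * mills w - 1)| <= B * (y - x) ^+ 2.
Proof.
pose B := (2 + z ^+ 2) * mills z + `|z| + 1.
have Mz := mills_ge0 z.
have B0 : 0 <= B by rewrite !addr_ge0// mulr_ge0// addr_ge0// sqr_ge0.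
exists B => // x w y zx /andP[xw wy].
have bound t : z <= t -> `|(1 + t ^+ 2) * mills t - t| <= B.
  move=> zt; rewrite ger0_norm ?subr_ge0 ?mills_lower//.
  have Mt := mills_ge0 t; have Mtz := mills_nonincreasing zt.
  have up := mills_upper t.
  have /ler_normlP [zn zp] := lexx `|z|.
  have [t1|t1] := leP 1 t.
    have : mills t <= 1 by nra.
    have : 0 <= (2 + z ^+ 2) * mills z by rewrite mulr_ge0// addr_ge0// sqr_ge0.
    have : t ^+ 2 * mills t <= t by rewrite expr2 -mulrA ger_pMr//; lra.
    by rewrite /B; lra.
  have : (1 + t ^+ 2) * mills t <= (2 + z ^+ 2) * mills z.
    apply: ler_pM => //; first by rewrite addr_ge0// sqr_ge0.
    have [t0|t0] := leP 0 t; [have := sqr_ge0 z|]; nra.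
  rewrite /B; lra.
have lip a b : z <= a -> a <= b ->
    `|(b * mills b - 1) - (a * mills a - 1)| <= B * (b - a).
  move=> za ab; have [c /andP[ac cb] ->] := mean_value ab (fun t _ => is_derive_mills' t).
  rewrite normrM (ger0_norm (_ : 0 <= b - a)) ?subr_ge0// ler_wpM2r ?subr_ge0//.
  exact: bound (le_trans za ac).
have xy := le_trans xw wy.
have [c /andP[xc cy] ->] := mean_value xy (fun t _ => is_derive_mills t).
rewrite mulrC -mulrBr normrM (ger0_norm (_ : 0 <= y - x)) ?subr_ge0//.
rewrite expr2 [leRHS]mulrCA ler_wpM2l ?subr_ge0//.
have [cw|/ltW wc] := leP c w.
  rewrite distrC; apply: le_trans (lip _ _ (le_trans zx xc) cw) _.
  by rewrite ler_wpM2l// lerB.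
apply: le_trans (lip _ _ (le_trans zx xw) wc) _.
by rewrite ler_wpM2l// lerB.
Qed.

(** The mean of [max (z - Z) 0] for a standard normal variable [Z], computed
    by integration by parts. *)
Definition gauss_put z : R := z * gauss_cdf z + phi z.

Lemma is_derive_gauss_put z : is_derive z 1 gauss_put (gauss_cdf z).
Proof.
have d1 := is_derive_gauss_cdf z; have d2 := is_derive_pdf z.
rewrite [X in is_derive _ _ X _](_ : _ = id * gauss_cdf + phi)//.
by apply: is_derive_eq; rewrite /GRing.scale/=; ring.
Qed.

(** The bounded solution [g] of the Stein equation for [x |-> max (z - x) 0],
    with [G] in the place of its derivative. On both sides of [z] it is an
    affine function of a Mills ratio, of [x] on the right and of [- x] on the
    left. The test function being continuous, the two pieces have the same
    value and the same derivative at [z], and their Taylor bounds can be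
    joined there. *)
Lemma stein_solution z : exists (g G : R -> R) (C : R), [/\ 0 <= C,
  (forall x, G x - x * g x = Num.max (z - x) 0 - gauss_put z) &
  (forall x y w, x <= w <= y ->
    `|g y - g x - (y - x) * G w| <= C * (y - x) ^+ 2)].
Proof.
pose J := gauss_put z.
pose g x := if x <= z then 1 + (z - J) * mills (- x) else J * mills x.
pose G x := if x <= z then (J - z) * (- x * mills (- x) - 1)
            else J * (x * mills x - 1).
have glue : 1 + (z - J) * mills (- z) = J * mills z.
  rewrite /mills opprK pdfN gauss_cdf_sym /J /gauss_put.
  by field; exact: lt0r_neq0 (pdf_gt0 z).
have gr x : z <= x -> g x = J * mills x.
  by rewrite /g le_eqVlt => /orP[/eqP <-|]; [rewrite lexx|rewrite ltNge => /negbTE->].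
have Gr x : z <= x -> G x = J * (x * mills x - 1).
  rewrite /G le_eqVlt => /orP[/eqP <-|]; last by rewrite ltNge => /negbTE->.
  by rewrite lexx [RHS]mulrBr [X in _ = X - _]mulrCA -glue; ring.
have [B1 B10 T1] := mills_taylor (- z).
have [B2 B20 T2] := mills_taylor z.
pose C := `|J - z| * B1 + `|J| * B2.
have C0 : 0 <= C by rewrite addr_ge0// mulr_ge0.
have left x w y : y <= z -> x <= w <= y ->
    `|g y - g x - (y - x) * G w| <= C * (y - x) ^+ 2.
  move=> yz /andP[xw wy].
  have wz := le_trans wy yz; have xz := le_trans xw wz.
  rewrite /g /G yz wz xz.
  have := T1 (- y) (- w) (- x); rewrite !lerN2 => /(_ yz).
  rewrite wy xw => /(_ isT) T.
  rewrite [X in `|X|](_ : _ = (J - z) * (mills (- x) - mills (- y) -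
     (- x - - y) * (- w * mills (- w) - 1))); last by ring.
  rewrite normrM (_ : y - x = - x - - y); last by ring.
  apply: le_trans (ler_wpM2l (normr_ge0 _) T) _.
  by rewrite mulrA ler_wpM2r ?sqr_ge0// lerDl mulr_ge0.
have right x w y : z <= x -> x <= w <= y ->
    `|g y - g x - (y - x) * G w| <= C * (y - x) ^+ 2.
  move=> zx /andP[xw wy].
  have zw := le_trans zx xw; have zy := le_trans zw wy.
  rewrite !gr// Gr//.
  rewrite [X in `|X|](_ : _ = J * (mills y - mills x -
     (y - x) * (w * mills w - 1))); last by ring.
  rewrite normrM.
  apply: le_trans (ler_wpM2l (normr_ge0 _) (T2 x w y zx _)) _; first by rewrite xw.
  by rewrite mulrA ler_wpM2r ?sqr_ge0// lerDr mulr_ge0.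
exists g, G, (3 * C); split; first by rewrite mulr_ge0.
  move=> x.
  have [xz|/ltW zx] := leP x z.
    rewrite /g /G xz max_l ?subr_ge0// /J; ring.
  rewrite gr// Gr// max_r ?subr_le0//. rewrite /J; ring.
move=> x y w /andP[xw wy].
have xy := le_trans xw wy.
have weaken (a b : R) : a <= C * b -> 0 <= b -> a <= 3 * C * b.
  by move=> ab b0; have : 0 <= C * b; [exact: mulr_ge0|nra].
have [yz|/ltW zy] := leP y z; first by rewrite weaken ?sqr_ge0// left// xw.
have [zx|xz] := leP z x; first by rewrite weaken ?sqr_ge0// right// xw.
(* Two Taylor bounds on the same interval, expanded at different points,
   compare the values of [G] at these points. *)
have comb a b v u : a < b -> `|g b - g a - (b - a) * G v| <= C * (b - a) ^+ 2 ->
    `|g b - g a - (b - a) * G u| <= C * (b - a) ^+ 2 ->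
    `|G v - G u| <= 2 * C * (b - a).
  move=> ab hv hu; rewrite -(ler_pM2l (_ : 0 < b - a)) ?subr_gt0//.
  rewrite -{1}(gtr0_norm (_ : 0 < b - a)) ?subr_gt0// -normrM.
  rewrite (_ : _ * (G v - G u) = (g b - g a - (b - a) * G u) -
    (g b - g a - (b - a) * G v)); last by ring.
  apply: le_trans (ler_normB _ _) _; nra.
have Gwz : `|G z - G w| <= 2 * C * (y - x).
  have [wz|/ltW zw] := leP w z.
    apply: le_trans (_ : 2 * C * (z - x) <= _); last first.
      by rewrite ler_wpM2l ?mulr_ge0// lerB.
    by apply: comb => //; apply: left; rewrite ?(ltW xz) ?lexx// xw.
  have [zy'|yz'] := ltP z y; last first.
    have -> : w = z by apply/le_anti; rewrite zw (le_trans wy).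
    by rewrite subrr normr0 !mulr_ge0// subr_ge0.
  apply: le_trans (_ : 2 * C * (y - z) <= _); last first.
    by rewrite ler_wpM2l ?mulr_ge0// lerB// ltW.
  by apply: comb => //; apply: right; rewrite ?lexx ?zy// zw.
have T1' : `|g z - g x - (z - x) * G z| <= C * (z - x) ^+ 2.
  by apply: left; rewrite ?lexx ?(ltW xz).
have T2' : `|g y - g z - (y - z) * G z| <= C * (y - z) ^+ 2.
  by apply: right; rewrite ?lexx ?zy.
rewrite [X in `|X|](_ : _ = (g z - g x - (z - x) * G z) +
  (g y - g z - (y - z) * G z) + (y - x) * (G z - G w)); last by ring.
apply: le_trans (ler_normD _ _) _.
have : `|(y - x) * (G z - G w)| <= 2 * C * (y - x) ^+ 2.
  rewrite normrM (ger0_norm (_ : 0 <= y - x)) ?subr_ge0//.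
  by rewrite expr2 mulrCA ler_wpM2l// subr_ge0.
have : (z - x) ^+ 2 + (y - z) ^+ 2 <= (y - x) ^+ 2.
  have : 0 <= (z - x) * (y - z) by rewrite mulr_ge0// subr_ge0// ltW.
  by nra.
move=> h; have : C * ((z - x) ^+ 2 + (y - z) ^+ 2) <= C * (y - x) ^+ 2.
  by rewrite ler_wpM2l.
have := ler_normD (g z - g x - (z - x) * G z) (g y - g z - (y - z) * G z).
by lra.
Qed.

End StandardNormal.

(** * The central limit theorem for sums of Bernoulli variables *)

(** The indicator of [x <= a] lies below and that of [x <= b] above
    [(max (b - x) 0 - max (a - x) 0) / (b - a)], whose normal mean is a
    difference quotient of [gauss_put], hence a value of its derivative
    [gauss_cdf] between [a] and [b]. The constant depends on [a] and [b] alone,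
    which makes the bound uniform over triangular arrays. *)
Lemma bernoulli_sum_clt (R : realType) (a b : R) : a < b ->
  exists2 C : R, 0 <= C & forall (I : finType) (p : I -> R) (s : R),
    (forall i, 0 <= p i <= 1) -> 0 < s -> s ^+ 2 = bvar p ->
    bprob p (fun c => bstd p s c <= a) <= gauss_cdf b + C / s /\
    gauss_cdf a - C / s <= bprob p (fun c => bstd p s c <= b).
Proof.
move=> ab.
have [ga [Ga [Ca [Ca0 ea ta]]]] := stein_solution a.
have [gb [Gb [Cb [Cb0 eb tb]]]] := stein_solution b.
have ba0 : 0 < b - a by rewrite subr_gt0.
exists ((Ca + Cb) / (b - a)); first by rewrite divr_ge0 ?(ltW ba0)// addr_ge0.
move=> I p s p01 s0 s2.
have put z g G C : (forall x, G x - x * g x = Num.max (z - x) 0 - gauss_put z) ->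
    (forall x y w, x <= w <= y ->
      `|g y - g x - (y - x) * G w| <= C * (y - x) ^+ 2) ->
    `|bexp p (fun c => Num.max (z - bstd p s c) 0) - gauss_put z| <= C / s.
  move=> e t; have := stein_bernoulli p01 s0 s2 t.
  rewrite (eq_bexp p (g := fun c => Num.max (z - bstd p s c) 0 - gauss_put z)).
    by rewrite bexpB bexp_cst.
  by move=> c; rewrite e.
have [] := (put _ _ _ _ ea ta, put _ _ _ _ eb tb).
rewrite !ler_norml => /andP[la ua] /andP[lb ub].
have [c /andP[ac cb] eJ] := mean_value (ltW ab) (fun t _ => is_derive_gauss_put t).
have cdf_mono x y : x <= y -> gauss_cdf x <= gauss_cdf y :> R.
  move=> xy; have [t _ e] := mean_value xy (fun t _ => is_derive_gauss_cdf t).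
  by rewrite -subr_ge0 e mulr_ge0 ?subr_ge0// ltW// pdf_gt0.
have := cdf_mono _ _ ac; have := cdf_mono _ _ cb => h1 h2.
set Eb := bexp p _ in lb ub; set Ea := bexp p _ in la ua.
have up : (b - a) * bprob p (fun c => bstd p s c <= a) <= Eb - Ea.
  rewrite -bexpB -bexpZ; apply: le_bexp => // v.
  have [va|va] := leP _ a; rewrite /= ?mulr1 ?mulr0.
    by rewrite !max_l; lra.
  by rewrite (max_r (_ : a - bstd p s v <= 0)) ?subr0 ?le_max ?lexx ?orbT//; lra.
have lo : Eb - Ea <= (b - a) * bprob p (fun c => bstd p s c <= b).
  rewrite -bexpB -bexpZ; apply: le_bexp => // v.
  have [vb|vb] := leP _ b; rewrite /= ?mulr1 ?mulr0.
    rewrite max_l ?subr_ge0//.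
    have : a - bstd p s v <= Num.max (a - bstd p s v) 0 by rewrite le_max lexx.
    by lra.
  by rewrite !max_r; lra.
have eC : (b - a) * ((Ca + Cb) / (b - a) / s) = Ca / s + Cb / s.
  by field; rewrite !lt0r_neq0.
have e1 : gauss_cdf c * (b - a) <= gauss_cdf b * (b - a).
  by rewrite ler_wpM2r// ltW.
have e2 : gauss_cdf a * (b - a) <= gauss_cdf c * (b - a).
  by rewrite ler_wpM2r// ltW.
by split; rewrite -(ler_pM2l ba0) ?mulrDr ?mulrN eC; lra.
Qed.

(** * The variance estimator as a function of indicators *)

Section BlockVariance.
Variables (R : realType) (I : finType) (p : I -> R) (Pi : {set {set I}}).
Hypothesis p01 : forall i, 0 <= p i <= 1.
Hypothesis Pi_part : finset.partition Pi [set: I]%SET.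
Hypothesis Pi_card : forall A, A \in Pi -> (2 <= #|A|)%N.
Hypothesis Pi_same : forall A, A \in Pi -> forall i j, i \in A -> j \in A -> p i = p j.
Implicit Types (b c : {ffun I -> bool}) (A : {set I}).

(** On the configuration of the indicators [X i <= t], this is [n] times the
    variance estimator computed with [t] instead of the empirical quantile. *)
Definition block_var b : R := \sum_(A in Pi) (#|A|%:R - 1)^-1 *
  \sum_(l1 in A) \sum_(l2 in A) (b l1 && ~~ b l2)%:R.

Lemma block_pairs b A : \sum_(l1 in A) \sum_(l2 in A) (b l1 && ~~ b l2)%:R =
  (\sum_(l in A) (b l)%:R) * (#|A|%:R - \sum_(l in A) (b l)%:R) :> R.
Proof.
rewrite big_distrl /=; apply: eq_bigr => i _.
rewrite -sum1_card natr_sum -sumrB big_distrr /=; apply: eq_bigr => j _.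
by case: (b i); case: (b j) => /=; ring.
Qed.

Lemma card_pred_gt0 A : A \in Pi -> 0 < #|A|%:R - 1 :> R.
Proof. by move=> /Pi_card A2; rewrite subr_gt0 ltr1n. Qed.

(** Only the block of [i], of size [m], is affected. If [K] of its other
    members are [true], switching [i] on changes [K (m - K) / (m - 1)] by
    [(m - 1 - 2 K) / (m - 1)], and [0 <= K <= m - 1]. *)
Lemma bosc_block_var i b : `|bosc i block_var b| <= 1.
Proof.
have /and3P[/eqP cov triv _] := Pi_part.
have iP : finset.pblock Pi i \in Pi by rewrite finset.pblock_mem// cov inE.
have iA : i \in finset.pblock Pi i by rewrite finset.mem_pblock cov inE.
set A := finset.pblock Pi i in iP iA.
have off x : \sum_(B in Pi | B != A) (#|B|%:R - 1)^-1 *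
      (\sum_(l1 in B) \sum_(l2 in B) (bset i x b l1 && ~~ bset i x b l2)%:R) =
    \sum_(B in Pi | B != A) (#|B|%:R - 1)^-1 *
      (\sum_(l1 in B) \sum_(l2 in B) (b l1 && ~~ b l2)%:R) :> R.
  apply: eq_bigr => B /andP[BP BA]; congr (_ * _).
  have iB : i \notin B.
    by apply: contraNN BA => iB; rewrite -(finset.def_pblock triv BP iB).
  apply: eq_bigr => j jB; apply: eq_bigr => k kB; rewrite !ffunE.
  by rewrite !ifN//; apply: contraNneq iB => <-.
rewrite /bosc /block_var (bigD1 A)//= [X in _ - X](bigD1 A)//= !off.
rewrite opprD addrACA subrr addr0 !block_pairs.
have sumE x : \sum_(l in A) (bset i x b l)%:R =
    x%:R + \sum_(l in A | l != i) (b l)%:R :> R.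
  rewrite (bigD1 i)//= ffunE eqxx; congr (_ + _).
  by apply: eq_bigr => l /andP[_ /negbTE li]; rewrite ffunE li.
rewrite !sumE; set N := \sum_(l in A | l != i) (b l)%:R.
have N0 : 0 <= N by apply: sumr_ge0.
have Nm : N <= #|A|%:R - 1.
  have -> : #|A|%:R - 1 = \sum_(l in A | l != i) 1 :> R.
    by rewrite -sum1_card natr_sum (bigD1 i)//= [LHS]addrC addKr.
  by apply: ler_sum => l _; case: (b l).
have m1 := card_pred_gt0 iP.
rewrite -mulrBr normrM (gtr0_norm (_ : 0 < _^-1)) ?invr_gt0//.
rewrite -ler_pdivlMl ?invr_gt0// invrK mulr1 ler_norml /=.
by apply/andP; split; lra.
Qed.

(** A pair of distinct members of a block contributes [p i (1 - p i)], and a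
    member [i] occurs in [#|A| - 1] ordered pairs of distinct members of its
    block [A], which the normalization of the estimator compensates. *)
Lemma bexp_block_var : bexp p block_var = bvar p.
Proof.
have /and3P[/eqP cov triv _] := Pi_part.
rewrite /block_var bexp_sum /bvar.
rewrite (eq_bigr (fun A : {set I} => \sum_(l in A) p l * (1 - p l))).
  rewrite -finset.big_trivIset//= cov; apply: eq_bigl => i; by rewrite inE.
move=> A AP; have m1 := card_pred_gt0 AP.
rewrite bexpZ bexp_sum big_distrr /=; apply: eq_bigr => i iA.
rewrite bexp_sum (bigD1 i)//= (eq_bexp p (g := fun=> 0)); last first.
  by move=> b; rewrite andbN.
rewrite bexp_cst add0r (eq_bigr (fun=> p i * (1 - p i))); last first.
  by move=> j /andP[jA ji]; rewrite bexp_coord2 1?eq_sym// (Pi_same AP jA iA).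
rewrite sumr_const -[X in _ * X]mulr_natl mulrA (_ : #|_|%:R = #|A|%:R - 1 :> R).
  by rewrite mulVf ?mul1r// lt0r_neq0.
rewrite (cardsD1 i A) iA natrD [RHS]addrC addKr; congr (_%:R).
by apply: eq_card => j; rewrite !inE andbC.
Qed.

End BlockVariance.

(** * The law of the indicators at a fixed threshold *)

Section Indicators.
Context d (T : measurableType d) (R : realType) (P : probability T R).
Variables (I : finType) (X : I -> {RV P >-> R}) (t : R).

Definition below (x : I -> R) (u : R) : {ffun I -> bool} :=
  [ffun i => x i <= u].

Let ray (b : bool) : set R := if b then `]-oo, t]%classic else `]t, +oo[%classic.

Let below_preimage b :
  [set w | below (X ^~ w) t = b] = \bigcap_(i in [set` [set: I]%SET]) X i @^-1` ray (b i).
Proof.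
apply/seteqP; split=> w /=.
  by move=> <- i _; rewrite /ray ffunE /=; case: leP => /= h; rewrite in_itv/= ?andbT.
move=> h; apply/ffunP => i; rewrite ffunE.
have := h i; rewrite /= inE => /(_ isT); rewrite /ray.
by case: (b i); rewrite /= in_itv/= ?andbT// => /lt_geF.
Qed.

Let measurable_ray b : measurable (ray b).
Proof. by case: b; exact: measurable_itv. Qed.

Let measurable_below1 b : measurable [set w | below (X ^~ w) t = b].
Proof.
rewrite below_preimage; apply: fin_bigcap_measurable => [|i _]; first exact: finite_finset.
by rewrite -[X in measurable X]setTI; exact: measurable_funP.
Qed.

Let belowE (E : pred {ffun I -> bool}) :
  [set w | E (below (X ^~ w) t)] =
  \bigcup_(b in [set` E]) [set w | below (X ^~ w) t = b].
Proof. by apply/seteqP; split=> [w Ew|w [b Eb /= ->]//]; exists (below (X ^~ w) t). Qed.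

Lemma measurable_below (E : pred {ffun I -> bool}) :
  measurable [set w | E (below (X ^~ w) t)].
Proof.
rewrite belowE; apply: fin_bigcup_measurable => // ; exact: finite_finset.
Qed.

Lemma prob_below (E : pred {ffun I -> bool}) : independent_RVs X ->
  P [set w | E (below (X ^~ w) t)] = (bprob (fun i => dist_fun (X i) t) E)%:E.
Proof.
move=> indep; have finE : finite_set [set` E] by exact: finite_finset.
have trivE : trivIset [set` E] (fun b => [set w | below (X ^~ w) t = b]).
  by move=> b c _ _ [w [/= <- <-]].
rewrite belowE (measure_fin_bigcup P finE trivE)//.
rewrite -(@bigfs _ _ _ _ (index_enum _)) ?index_enum_uniq//; last first.
  by move=> b _; rewrite mem_index_enum.
rewrite /bprob /bexp -sumEFin [LHS]big_mkcond; apply: eq_bigr => b _.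
case: (E b) => /=; last by rewrite mulr0.
rewrite mulr1 below_preimage indep; last by move=> i.
rewrite /bweight -prodEFin; apply: eq_big => [i|i _]; first by rewrite inE.
have cdfE : P (X i @^-1` `]-oo, t]%classic) = (dist_fun (X i) t)%:E.
  by rewrite /dist_fun fineK// fin_num_measure.
case: (b i); rewrite /ray//.
rewrite (_ : _ @^-1` _ = ~` (X i @^-1` `]-oo, t]%classic)); last first.
  by apply/seteqP; split=> w /=; rewrite !in_itv/= andbT ltNge => /negP.
rewrite probability_setC ?cdfE ?EFinB//.
by rewrite -[X in measurable X]setTI; exact: measurable_funP.
Qed.

End Indicators.

(** * Quantiles *)

Section Quantiles.
Variable R : realType.

Lemma continuous_quantile (G : R -> R) (p : R) : {homo G : x y / x <= y} ->
  continuous G -> (exists x, G x < p) -> (exists x, p <= G x) ->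
  G (quantile G p) = p.
Proof.
move=> Gmono Gcont [x0 Gx0] [x1 Gx1]; rewrite /quantile.
set E := [set x | p <= G x].
have Elb : has_lbound E.
  exists x0 => y /= py; rewrite leNgt; apply/negP => /ltW /Gmono.
  by rewrite leNgt (lt_le_trans Gx0).
have E0 : E !=set0 by exists x1.
set q := inf E.
apply/le_anti/andP; split.
  rewrite leNgt; apply/negP => Gq.
  have /cvgr_gt/(_ _ Gq) [e /= e0 He] := Gcont q.
  have : q <= q - e / 2.
    apply: ge_inf => //=; apply/ltW/He; rewrite /= opprB addrC subrK.
    by rewrite gtr0_norm ?divr_gt0// gtr_pMr// invf_lt1// ltr1n.
  by rewrite lerBrDr gerDl leNgt divr_gt0.
rewrite leNgt; apply/negP => Gq.
have /cvgr_lt/(_ _ Gq) [e /= e0 He] := Gcont q.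
have [y /= py yq] := inf_adherent e0 (conj E0 Elb).
have qy : q <= y by apply: ge_inf.
have : G y < p.
  by apply: He; rewrite /= distrC ger0_norm ?subr_ge0// ltrBlDl.
by rewrite ltNge py.
Qed.

Section EmpiricalQuantile.
Variables (n : nat) (x : 'I_n -> R) (tau : R).
Hypothesis n0 : (0 < n)%N.

Lemma emp_dfE t : n%:R * emp_df x t = bcount R (below x t).
Proof.
rewrite /emp_df mulrA divff ?mul1r ?pnatr_eq0 -?lt0n//.
by apply: eq_bigr => i _; rewrite ffunE.
Qed.

Lemma emp_df_mono : {homo emp_df x : s t / s <= t}.
Proof.
move=> s t st; rewrite ler_wpM2l ?invr_ge0//; apply: ler_sum => i _.
by rewrite ler_nat; case: (leP (x i) s) => // /le_trans ->.
Qed.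

Lemma emp_quantile_le t : 0 < tau -> tau <= emp_df x t -> emp_quantile x tau <= t.
Proof.
move=> tau0 ht; apply: ge_inf => //; exists (- \sum_i `|x i|) => y /= py.
rewrite leNgt; apply/negP => yl; move: py; rewrite leNgt => /negP; apply.
rewrite /emp_df big1 ?mulr0// => i _.
rewrite [_ <= _]leNgt (lt_le_trans yl)//= lerNl (le_trans (ler_norm _))// normrN.
by rewrite (bigD1 i)//= lerDl sumr_ge0.
Qed.

Lemma emp_quantile_ge t : tau <= 1 -> emp_df x t < tau -> t <= emp_quantile x tau.
Proof.
move=> tau1 ht; apply: lb_le_inf => [|y /= py].
  exists (\sum_i `|x i|) => /=; apply: le_trans tau1 _.
  rewrite /emp_df (eq_bigr (fun=> 1)) ?sumr_const ?card_ord; last first.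
    move=> i _; rewrite (le_trans (ler_norm _))//.
    by rewrite (bigD1 i)//= lerDl sumr_ge0.
  by rewrite mulVf// pnatr_eq0 -lt0n.
rewrite leNgt; apply/negP => /ltW/emp_df_mono; rewrite leNgt => /negP; apply.
exact: lt_le_trans ht py.
Qed.

Lemma var_estE (Pi : {set {set 'I_n}}) :
  n%:R * var_est Pi x tau = block_var R Pi (below x (emp_quantile x tau)).
Proof.
rewrite /var_est mulrA divff ?mul1r ?pnatr_eq0 -?lt0n//.
apply: eq_bigr => A _; congr (_ * _); apply: eq_bigr => i _; apply: eq_bigr => j _.
by rewrite !ffunE -ltNge.
Qed.

End EmpiricalQuantile.
End Quantiles.

Section DistributionFunctions.
Context d (T : measurableType d) (R : realType) (P : probability T R).
Implicit Type X : {RV P >-> R}.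

Lemma dist_funE X x : (dist_fun X x)%:E = P [set w | X w <= x].
Proof.
by rewrite /dist_fun fineK ?fin_num_measure.
Qed.

Lemma dist_fun_itv X x : 0 <= dist_fun X x <= 1.
Proof.
by rewrite -!lee_fin /dist_fun fineK ?fin_num_measure// cdf_ge0 cdf_le1.
Qed.

Lemma dist_fun_mono X : {homo dist_fun X : x y / x <= y}.
Proof.
by move=> x y xy; rewrite fine_le ?fin_num_measure//; exact: cdf_nondecreasing.
Qed.

Lemma cvg_dist_funy X : dist_fun X x @[x --> +oo] --> (1 : R).
Proof. exact: (fine_cvg (cvg_cdfy1 X)). Qed.

Lemma cvg_dist_funNy X : dist_fun X x @[x --> -oo] --> (0 : R).
Proof. exact: (fine_cvg (cvg_cdfNy0 X)). Qed.

Lemma mean_df_mono n (F : 'I_n -> R -> R) :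
  (forall i, {homo F i : x y / x <= y}) -> {homo mean_df F : x y / x <= y}.
Proof.
move=> Fm x y xy; rewrite ler_wpM2l ?invr_ge0//; apply: ler_sum => i _; exact: Fm.
Qed.

Lemma mean_quantileE n (X : 'I_n -> {RV P >-> R}) (p : R) : (0 < n)%N ->
  let F i := dist_fun (X i) in
  continuous (mean_df F) -> 0 < p < 1 -> mean_df F (mean_quantile F p) = p.
Proof.
move=> n0 F Fc /andP[p0 p1].
have nu : (n%:R : R) \is a GRing.unit by rewrite unitfE pnatr_eq0 -lt0n.
have mean_cst (c : R) : n%:R^-1 * \sum_(i < n) c = c.
  by rewrite sumr_const card_ord -[X in _ * X]mulr_natl mulKr.
apply: continuous_quantile => //.
- by apply: mean_df_mono => i; exact: dist_fun_mono.
- have p20 : 0 < p / 2 by rewrite divr_gt0.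
  have [x Hx] := filter_ex (@filter_forall _ _ (fun i x => F i x < p / 2) _ _
    (fun i => cvgr_lt _ (cvg_dist_funNy (X i)) _ p20)).
  exists x; apply: (@le_lt_trans _ _ (p / 2)); last by lra.
  rewrite -[leRHS]mean_cst ler_wpM2l ?invr_ge0//.
  by apply: ler_sum => i _; exact: ltW.
- have [x Hx] := filter_ex (@filter_forall _ _ (fun i x => p < F i x) _ _
    (fun i => cvgr_gt _ (cvg_dist_funy (X i)) _ p1)).
  exists x; rewrite -[leLHS]mean_cst ler_wpM2l ?invr_ge0//.
  by apply: ler_sum => i _; exact: ltW.
Qed.

End DistributionFunctions.

(** * Comparison of the estimator with its target on a good event *)

(** The bounds on the counts at [qm] and [qp] force the empirical quantile into
    [[qm, qp]], where also [q] lies; the configurations at the empirical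
    quantile and at [q] then differ only for observations between [qm] and
    [qp], of which there are fewer than [4 e]. *)
Lemma var_est_close (R : realType) (n : nat) (x : 'I_n -> R) (Pi : {set {set 'I_n}})
    (tau v e qm q qp : R) :
  finset.partition Pi [set: 'I_n]%SET -> (forall A, A \in Pi -> (2 <= #|A|)%N) ->
  (0 < n)%N -> 0 < tau < 1 -> qm <= q <= qp ->
  `|block_var R Pi (below x q) - v| < e ->
  `|bcount R (below x qp) - (n%:R * tau + e)| < e ->
  `|bcount R (below x qm) - (n%:R * tau - e)| < e ->
  `|n%:R * var_est Pi x tau - v| < 5 * e.
Proof.
move=> Ppart Pcard n0 /andP[tau0 tau1] /andP[qmq qqp] hU.
move=> /ltr_normlP[hp1 hp2] /ltr_normlP[hm1 hm2].
have nR0 : 0 < n%:R :> R by rewrite ltr0n.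
set Q := emp_quantile x tau.
have Qqp : Q <= qp.
  by apply: emp_quantile_le => //; rewrite -(ler_pM2l nR0) emp_dfE//; lra.
have qmQ : qm <= Q.
  by apply: emp_quantile_ge; rewrite ?(ltW tau1)// -(ltr_pM2l nR0) emp_dfE//; lra.
rewrite var_estE// -/Q.
have := bosc_lipschitz (bosc_block_var R Ppart Pcard) (below x Q) (below x q).
have : \sum_i 1 * (below x Q i != below x q i)%:R <=
    bcount R (below x qp) - bcount R (below x qm).
  rewrite /bcount -sumrB; apply: ler_sum => i _; rewrite mul1r !ffunE.
  have bool_gap (a b c d : bool) : (a -> b) -> (a -> c) -> (b -> d) -> (c -> d) ->
      (b != c)%:R <= d%:R - a%:R :> R.
    by move: a b c d => [] [] [] [] h1 h2 h3 h4 /=;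
      first [lra | have := h1 isT | have := h2 isT | have := h3 isT | have := h4 isT].
  by apply: bool_gap => /le_trans; apply.
move=> h1 h2.
have := ler_normD (block_var R Pi (below x Q) - block_var R Pi (below x q))
  (block_var R Pi (below x q) - v).
rewrite subrKA; lra.
Qed.

(** With [r = sqrt (m w / v)] one has [S = y r], and [|r - 1| <= |r ^ 2 - 1|]
    for nonnegative [r]. Perturbing the threshold [x] instead of [S] avoids
    any bound on [S]. *)
Lemma studentized_sandwich (R : realType) (m N w v k x : R) :
  0 < m -> 0 < v -> k < 1 -> `|m * w - v| <= k * v ->
  let y := Num.sqrt (m / w) * (N / m) in
  let S := N / Num.sqrt v in
  (y <= x -> S <= x + `|x| * k) /\ (S <= x - `|x| * k -> y <= x).
Proof.
move=> m0 v0 k1 hw y S.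
have W0 : 0 < m * w by move: hw; rewrite ler_norml => /andP[h _]; nra.
have w0 : 0 < w by rewrite -(pmulr_rgt0 _ m0).
have sv0 : 0 < Num.sqrt v by rewrite sqrtr_gt0.
have sW0 : 0 < Num.sqrt (m * w) by rewrite sqrtr_gt0.
have yE : y = N / Num.sqrt (m * w).
  rewrite /y (_ : m / w = m ^+ 2 / (m * w)); last by field; rewrite !lt0r_neq0.
  rewrite sqrtrM ?sqr_ge0// sqrtr_sqr gtr0_norm// sqrtrV ?(ltW W0)//.
  by field; rewrite !lt0r_neq0.
pose r := Num.sqrt (m * w) / Num.sqrt v.
have r0 : 0 < r by rewrite divr_gt0.
have SE : S = y * r by rewrite yE /S /r; field; rewrite !lt0r_neq0.
have r2 : r ^+ 2 * v = m * w.
  rewrite /r expr_div_n !sqr_sqrtr ?ltW//.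
  by field; rewrite !lt0r_neq0.
have rk : `|r - 1| <= k.
  have : `|r - 1| * (r + 1) <= k.
    rewrite -(gtr0_norm (_ : 0 < r + 1)) ?addr_gt0// -normrM.
    rewrite -(ler_pM2r v0) -{1}(gtr0_norm v0) -normrM.
    by rewrite (_ : (r - 1) * (r + 1) * v = m * w - v)// -r2; ring.
  by apply: le_trans; rewrite ler_peMr// lerDr ltW.
have xr : `|x * r - x| <= `|x| * k.
  by rewrite (_ : x * r - x = x * (r - 1)) ?normrM ?ler_wpM2l//; ring.
move: xr; rewrite ler_norml => /andP[xr1 xr2].
rewrite SE; split=> h.
  by have : y * r <= x * r by [rewrite ler_pM2r]; lra.
by rewrite -(ler_pM2r r0); lra.
Qed.

(** * Bounds for a fixed sample size *)

Lemma bvar_het_var (R : realType) (n : nat) (F : 'I_n -> R -> R) (tau : R) :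
  (0 < n)%N -> bvar (F^~ (mean_quantile F tau)) = n%:R * het_var F tau.
Proof. by move=> n0; rewrite /het_var mulrA divff ?mul1r// pnatr_eq0 -lt0n. Qed.

Section FixedSampleSize.
Context d (T : measurableType d) (R : realType) (P : probability T R).
Variables (n : nat) (X : 'I_n -> {RV P >-> R}) (Pi : {set {set 'I_n}}) (tau : R).
Let F i := dist_fun (X i).
Hypothesis n0 : (0 < n)%N.
Hypothesis indep : independent_RVs X.
Hypothesis Fcont : continuous (mean_df F).
Hypothesis Pi_part : finset.partition Pi [set: 'I_n]%SET.
Hypothesis Pi_card : forall A, A \in Pi -> (2 <= #|A|)%N.
Hypothesis Pi_same : forall A, A \in Pi ->
  forall i i', i \in A -> i' \in A -> F i = F i'.
Hypothesis tau01 : 0 < tau < 1.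
Let q := mean_quantile F tau.
Let p i := F i q.
Let v := n%:R * het_var F tau.
Hypothesis v0 : 0 < v.

Let nR0 : 0 < n%:R :> R. Proof. by rewrite ltr0n. Qed.

Let F01 t i : 0 <= F i t <= 1. Proof. exact: dist_fun_itv. Qed.

Let bvarE : bvar p = v.
Proof. exact: bvar_het_var. Qed.

Let bexp_countE t : bexp (F^~ t) (@bcount R _) = n%:R * mean_df F t.
Proof. by rewrite bexp_count /mean_df mulrA divff ?mul1r// lt0r_neq0. Qed.

(* These bounds leave room around [tau] for the levels used below. *)
Let het_var_le : het_var F tau <= tau /\ het_var F tau <= 1 - tau.
Proof.
have eF : mean_df F q = tau by exact: mean_quantileE.
rewrite -{2 4}eF /mean_df /het_var; split.
  rewrite ler_wpM2l ?invr_ge0//; apply: ler_sum => i _.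
  by have /andP[f0 f1] := F01 q i; rewrite ler_piMr ?gerBl.
rewrite -(ler_pM2l nR0) mulrBr !mulrA divff ?lt0r_neq0// !mul1r mulr1.
rewrite [X in _ <= X - _](_ : _ = \sum_(i < n) 1); last first.
  by rewrite sumr_const card_ord.
rewrite -sumrB; apply: ler_sum => i _.
by have /andP[f0 f1] := F01 q i; rewrite ler_piMl// subr_ge0.
Qed.

(** At the quantile [t] of level [tau + e / n] the sum of the [F i t] is off
    [n tau] by [e]. As all [F i] move in the same direction from [q] to [t],
    each summand of the variance of the count changes by no more than [F i]
    does, so that this variance is at most [v + delta v], and Chebyshev
    applies. *)
Lemma count_deviation (delta e : R) : 0 < delta < 1 -> `|e| = delta * v ->
  let t := mean_quantile F (tau + e / n%:R) in
  mean_df F t = tau + e / n%:R /\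
  bprob (F^~ t) (fun b => delta * v <= `|bcount R b - (n%:R * tau + e)|) <=
    2 / (delta ^+ 2 * v).
Proof.
move=> /andP[d0 d1] eE t.
have [h1 h2] := het_var_le.
have /andP[tau0 tau1] := tau01.
have hv0 : 0 < het_var F tau by rewrite -(pmulr_rgt0 _ nR0).
have e_n : `|e / n%:R| = delta * het_var F tau.
  by rewrite normrM eE normfV (gtr0_norm nR0) /v; field; exact: lt0r_neq0.
have te : mean_df F t = tau + e / n%:R.
  apply: mean_quantileE => //; have := lexx `|e / n%:R|.
  rewrite {2}e_n ler_norml => /andP[e1 e2].
  have : delta * het_var F tau < het_var F tau by rewrite gtr_pMl.
  by move=> h; apply/andP; split; lra.
split=> //.
have cE : bexp (F^~ t) (@bcount R _) = n%:R * tau + e.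
  by rewrite bexp_countE te; field; exact: lt0r_neq0.
have := @bprob_chebyshev R _ (F^~ t) (F01 t) (fun=> 1) (@bcount R _) (delta * v).
rewrite cE => /(_ (mulr_gt0 d0 v0)) cheb; apply: le_trans (cheb _) _.
  by move=> i b; rewrite bosc_count normr1.
have diffE : \sum_i (F i t - p i) = e.
  rewrite sumrB -[X in X - _]bexp_count cE -[X in _ - X]bexp_count bexp_countE.
  by rewrite (mean_quantileE n0)//; ring.
have abs_diff : \sum_i `|F i t - p i| = `|e|.
  rewrite -diffE; have [qt|/ltW tq] := leP q t.
    have ge0 i : 0 <= F i t - p i by rewrite subr_ge0; exact: dist_fun_mono.
    rewrite ger0_norm; last by apply: sumr_ge0 => i _; exact: ge0.
    by apply: eq_bigr => i _; rewrite ger0_norm.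
  have le0 i : F i t - p i <= 0 by rewrite subr_le0; exact: dist_fun_mono.
  rewrite ler0_norm; last by apply: sumr_le0 => i _; exact: le0.
  by rewrite -sumrN; apply: eq_bigr => i _; rewrite ler0_norm.
have var_le : \sum_i F i t * (1 - F i t) * 1 ^+ 2 <= v + delta * v.
  rewrite -eE -abs_diff -bvarE -big_split; apply: ler_sum => i _ /=.
  have /andP[f0 f1] := F01 t i; have /andP[g0 g1] := F01 q i.
  rewrite expr1n mulr1 -lerBlDl.
  rewrite (_ : _ - _ = (F i t - p i) * (1 - F i t - p i)); last by ring.
  apply: le_trans (ler_norm _) _; rewrite normrM ler_piMr//.
  by rewrite ler_norml /p; lra.
have dv0 : 0 < delta * v by exact: mulr_gt0.
rewrite ler_pdivrMr ?exprn_gt0//.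
have -> : 2 / (delta ^+ 2 * v) * (delta * v) ^+ 2 = 2 * v.
  by field; rewrite !lt0r_neq0.
have : delta * v <= v by rewrite ger_pMl// ltW.
by lra.
Qed.

Lemma block_var_deviation (delta : R) : 0 < delta ->
  bprob p (fun b => delta * v <= `|block_var R Pi b - v|) <= (delta ^+ 2 * v)^-1.
Proof.
move=> d0.
have bE : bexp p (block_var R Pi) = v.
  rewrite bexp_block_var// => A AP i j iA jA.
  by rewrite /p (Pi_same AP iA jA).
have := @bprob_chebyshev R _ p (F01 q) (fun=> 1) (block_var R Pi) (delta * v).
rewrite bE => /(_ (mulr_gt0 d0 v0)) cheb; apply: le_trans (cheb _) _.
  by move=> i b; exact: bosc_block_var.
rewrite (eq_bigr (fun i => p i * (1 - p i))); last by move=> i _; rewrite expr1n mulr1.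
rewrite -/(bvar p) bvarE le_eqVlt; apply/orP; left; apply/eqP.
by field; rewrite !lt0r_neq0.
Qed.

(** Outside three events of probability at most [1], [2] and [2] times
    [1 / (delta ^ 2 v)], the event [Y <= x] is sandwiched between two events on
    the standardized count at [q]. *)
Lemma studentized_df_bounds (Y : {RV P >-> R}) (delta x : R) :
  0 < delta -> 5 * delta < 1 ->
  (forall w : T, var_est Pi (fun i => X i w) tau != 0 ->
    Y w = Num.sqrt (n%:R / var_est Pi (fun i => X i w) tau) *
      (emp_df (fun i => X i w) q - tau)) ->
  dist_fun Y x <=
    bprob p (fun b => bstd p (Num.sqrt v) b <= x + `|x| * (5 * delta)) +
    5 / (delta ^+ 2 * v) /\
  bprob p (fun b => bstd p (Num.sqrt v) b <= x - `|x| * (5 * delta)) -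
    5 / (delta ^+ 2 * v) <= dist_fun Y x.
Proof.
move=> d0 d5 HY.
have d01 : 0 < delta < 1 by apply/andP; split; lra.
have dv0 : 0 < delta * v by exact: mulr_gt0.
have [] := count_deviation d01 (gtr0_norm dv0).
set qp := mean_quantile F _ => eqp devp.
have [] := count_deviation d01 (etrans (normrN _) (gtr0_norm dv0)).
set qm := mean_quantile F _ => eqm devm.
have devq := block_var_deviation d0.
have eq_ : mean_df F q = tau by exact: mean_quantileE.
have Fmono : {homo mean_df F : s t / s <= t}.
  by apply: mean_df_mono => i; exact: dist_fun_mono.
have dvn : 0 < delta * v / n%:R by rewrite divr_gt0.
have qmq : qm <= q.
  rewrite leNgt; apply/negP => /ltW/Fmono; rewrite eqm eq_ mulNr; lra.
have qqp : q <= qp.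
  rewrite leNgt; apply/negP => /ltW/Fmono; rewrite eqp eq_; lra.
pose B1 := [set w | delta * v <= `|block_var R Pi (below (X^~ w) q) - v|].
pose B2 := [set w | delta * v <=
  `|bcount R (below (X^~ w) qp) - (n%:R * tau + delta * v)|].
pose B3 := [set w | delta * v <=
  `|bcount R (below (X^~ w) qm) - (n%:R * tau + - (delta * v))|].
pose S z := [set w | bstd p (Num.sqrt v) (below (X^~ w) q) <= z].
have mS z : measurable (S z).
  exact: (measurable_below X q (fun b => bstd p (Num.sqrt v) b <= z)).
have mB1 : measurable B1.
  exact: (measurable_below X q (fun b => delta * v <= `|block_var R Pi b - v|)).
have mB2 : measurable B2.
  exact: (measurable_below X qp
    (fun b => delta * v <= `|bcount R b - (n%:R * tau + delta * v)|)).
have mB3 : measurable B3.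
  exact: (measurable_below X qm
    (fun b => delta * v <= `|bcount R b - (n%:R * tau + - (delta * v))|)).
have mY : measurable [set w | Y w <= x].
  rewrite (_ : [set w | _] = [set: T] `&` Y @^-1` `]-oo, x]%classic).
    exact: measurable_funP.
  by rewrite setTI; apply/seteqP; split=> w /=; rewrite in_itv.
have PS z : P (S z) = (bprob p (fun b => bstd p (Num.sqrt v) b <= z))%:E.
  exact: (prob_below q (fun b => bstd p (Num.sqrt v) b <= z) indep).
have PB1 : (P B1 <= ((delta ^+ 2 * v)^-1)%:E)%E.
  have := prob_below q (fun b => delta * v <= `|block_var R Pi b - v|) indep.
  by move=> /= ->; rewrite lee_fin.
have PB2 : (P B2 <= (2 / (delta ^+ 2 * v))%:E)%E.
  have := prob_below qp
    (fun b => delta * v <= `|bcount R b - (n%:R * tau + delta * v)|) indep.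
  by move=> /= ->; rewrite lee_fin.
have PB3 : (P B3 <= (2 / (delta ^+ 2 * v))%:E)%E.
  have := prob_below qm
    (fun b => delta * v <= `|bcount R b - (n%:R * tau + - (delta * v))|) indep.
  by move=> /= ->; rewrite lee_fin.
have PB : (P (B1 `|` (B2 `|` B3)) <= (5 / (delta ^+ 2 * v))%:E)%E.
  apply: le_trans (measureU2 _ _ _) _ => //; first exact: measurableU.
  have -> : 5 / (delta ^+ 2 * v) = (delta ^+ 2 * v)^-1 +
     (2 / (delta ^+ 2 * v) + 2 / (delta ^+ 2 * v)).
    by field; rewrite !lt0r_neq0.
  rewrite EFinD; apply: leeD; first exact: PB1.
  apply: le_trans (measureU2 _ _ _) _ => //.
  by rewrite EFinD; apply: leeD; [exact: PB2|exact: PB3].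
have good w : ~ (B1 `|` (B2 `|` B3)) w ->
  (Y w <= x -> S (x + `|x| * (5 * delta)) w) /\
  (S (x - `|x| * (5 * delta)) w -> Y w <= x).
  move=> /not_orP[/negP h1 /not_orP[/negP h2 /negP h3]].
  rewrite -ltNge in h1; rewrite -ltNge in h2; rewrite -ltNge in h3.
  have qq : qm <= q <= qp by rewrite qmq.
  have /ltW := var_est_close Pi_part Pi_card n0 tau01 qq h1 h2 h3.
  rewrite mulrA => close.
  have [] := studentized_sandwich (bcount R (below (X^~ w) q) - n%:R * tau) x nR0 v0 d5 close.
  have ve0 : var_est Pi (X^~ w) tau != 0.
    apply/eqP => ve0; move: close; rewrite ve0 mulr0 sub0r normrN gtr0_norm//.
    by rewrite leNgt gtr_pMl// d5.
  have -> : Y w = Num.sqrt (n%:R / var_est Pi (X^~ w) tau) *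
      ((bcount R (below (X^~ w) q) - n%:R * tau) / n%:R).
    rewrite HY//; congr (_ * _); rewrite -emp_dfE//.
    by field; exact: lt0r_neq0.
  by rewrite /S /= /bstd bexp_countE eq_.
split; rewrite -lee_fin ?EFinD.
  rewrite dist_funE -PS.
  apply: (@le_trans _ _ (P (S (x + `|x| * (5 * delta)) `|` (B1 `|` (B2 `|` B3))))).
    apply: le_measure; rewrite ?inE//; first by do !apply: measurableU.
    move=> w Yw; have [Bw|Bw] := pselect ((B1 `|` (B2 `|` B3)) w); first by right.
    by left; apply: (good w Bw).1.
  apply: le_trans (measureU2 _ _ _) _ => //; first by do !apply: measurableU.
  by rewrite leeD2l.
rewrite EFinN leeBlDr// dist_funE -PS.
apply: (@le_trans _ _ (P ([set w | Y w <= x] `|` (B1 `|` (B2 `|` B3))))).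
  apply: le_measure; rewrite ?inE//; first by do !apply: measurableU.
  move=> w Sw; have [Bw|Bw] := pselect ((B1 `|` (B2 `|` B3)) w); first by right.
  by left; apply: (good w Bw).2.
apply: le_trans (measureU2 _ _ _) _ => //; first by do !apply: measurableU.
by rewrite leeD2l.
Qed.

End FixedSampleSize.

(** * Asymptotic normality *)

Theorem theorem1 (R : realType) (d : nat -> measure_display)
    (T : forall n, measurableType (d n)) (P : forall n, probability (T n) R)
    (X : forall n, 'I_n -> {RV (P n) >-> R})
    (F : forall n, 'I_n -> R -> R)
    (Pi : forall n, {set {set 'I_n}})
    (HF : forall (n : nat) (i : 'I_n), F n i = dist_fun (X n i))
    (Hindep : forall n, (2 <= n)%N -> independent_RVs (X n))
    (Hcont : forall n, (2 <= n)%N -> continuous (mean_df (F n)))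
    (Hpart : forall n, (2 <= n)%N -> finset.partition (Pi n) [set: 'I_n]%SET)
    (Hcard : forall n, (2 <= n)%N -> forall A, A \in Pi n -> (2 <= #|A|)%N)
    (Hsame : forall n, (2 <= n)%N -> forall A, A \in Pi n ->
       forall i i', i \in A -> i' \in A -> F n i = F n i')
    (tau : R) (Htau : 0 < tau < 1)
    (Hvar : n%:R * het_var (F n) tau @[n --> \oo] --> +oo)
    (Y : forall n, {RV (P n) >-> R})
    (HY : forall n, (2 <= n)%N -> forall w : T n,
       var_est (Pi n) (fun i => X n i w) tau != 0 ->
       Y n w = Num.sqrt (n%:R / var_est (Pi n) (fun i => X n i w) tau) *
         (emp_df (fun i => X n i w) (mean_quantile (F n) tau) - tau)) :
  cvg_in_distribution Y (normal_prob (0 : R) 1).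
Proof.
have FE n : F n = fun i => dist_fun (X n i) by apply/funext => i; exact: HF.
move=> x _.
suff : cdf (Y n) x @[n --> \oo] --> (gauss_cdf x)%:E by rewrite gauss_cdfE.
apply: cvg_EFin.
  by apply: nearW => n; exact: fin_num_measure.
apply/cvgrPdist_le => eps eps0.
have eps3 : 0 < eps / 3 by rewrite divr_gt0.
have cdf_cont : {for x, continuous (@gauss_cdf R)}.
  have [dF _] := is_derive_gauss_cdf x.
  exact/differentiable_continuous/derivable1_diffP.
have /cvgrPdist_lt /(_ _ eps3) [r /= r0 Hr] := cdf_cont.
(* The farthest points at which the normal distribution function is compared,
   at distance [|x| (5 delta) + delta] from [x], have to stay where [gauss_cdf] varies by
   less than [eps / 3]. *)
pose delta := Num.min (10^-1) (r / (2 * (5 * `|x| + 1))).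
have x50 : 0 < 5 * `|x| + 1 by rewrite ltr_wpDl// mulr_ge0.
have d0 : 0 < delta by rewrite lt_min invr_gt0 ltr0n divr_gt0// mulr_gt0.
have d10 : delta <= 10^-1 by rewrite ge_min lexx.
have dr : `|x| * (5 * delta) + delta < r.
  have : delta <= r / (2 * (5 * `|x| + 1)) by rewrite ge_min lexx orbT.
  by rewrite ler_pdivlMr ?mulr_gt0//; lra.
have d5 : 5 * delta < 1 by lra.
have xd0 : 0 <= `|x| * (5 * delta) by rewrite !mulr_ge0// ltW.
pose u := x + `|x| * (5 * delta); pose l := x - `|x| * (5 * delta).
have lu : u < u + delta by rewrite ltrDl.
have ll : l - delta < l by rewrite gtrBl.
have [C1 C10 clt1] := bernoulli_sum_clt lu.
have [C2 C20 clt2] := bernoulli_sum_clt ll.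
pose K := C1 + C2 + 5 / delta ^+ 2.
have K0 : 0 <= K by rewrite !addr_ge0// divr_ge0// sqr_ge0.
have up : gauss_cdf (u + delta) < gauss_cdf x + eps / 3.
  have := Hr (u + delta).
  rewrite /= distrC (_ : u + delta - x = `|x| * (5 * delta) + delta); last first.
    by rewrite /u; ring.
  rewrite ger0_norm ?addr_ge0 ?(ltW d0)// => /(_ dr).
  by rewrite ltr_norml => /andP[]; lra.
have lo : gauss_cdf x - eps / 3 < gauss_cdf (l - delta).
  have := Hr (l - delta).
  rewrite /= (_ : x - (l - delta) = `|x| * (5 * delta) + delta); last first.
    by rewrite /l; ring.
  rewrite ger0_norm ?addr_ge0 ?(ltW d0)// => /(_ dr).
  by rewrite ltr_norml => /andP[]; lra.
have /cvgryPgt /(_ (1 + (3 * K / eps) ^+ 2)) := Hvar.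
apply: filterS2 (nbhs_infty_ge 2) => n n2 vn.
have n0 : (0 < n)%N by apply: leq_trans n2.
move: (Hcont n n2) (Hsame n n2) (HY n n2) vn; rewrite FE => Fcont Fsame Yeq.
set v := n%:R * _ => vn.
have v1 : 1 < v by apply: le_lt_trans vn; rewrite lerDl sqr_ge0.
have v0 : 0 < v by apply: lt_trans v1.
pose s := Num.sqrt v.
have s0 : 0 < s by rewrite sqrtr_gt0.
have s2 : s ^+ 2 = v by rewrite sqr_sqrtr// ltW.
have s1 : 1 < s by rewrite -(ltr_pXn2r (_ : (0 < 2)%N))// ?nnegrE ?(ltW s0)// expr1n s2.
have sK : 3 * K / eps < s.
  rewrite -(ltr_pXn2r (_ : (0 < 2)%N))// ?nnegrE ?(ltW s0)//.
    by rewrite s2; lra.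
  by rewrite divr_ge0 ?mulr_ge0// ltW.
have Ks : K / s <= eps / 3.
  by rewrite ler_pdivrMr//; move: sK; rewrite ltr_pdivrMr//; lra.
have sv : (delta ^+ 2 * v)^-1 <= (delta ^+ 2)^-1 / s.
  rewrite invfM ler_wpM2l ?invr_ge0 ?sqr_ge0// lef_pV2 ?posrE// -s2 expr2.
  by rewrite ler_peMl// ltW.
have KE : K / s = C1 / s + C2 / s + 5 * ((delta ^+ 2)^-1 / s).
  by rewrite /K; ring.
have C1s : 0 <= C1 / s by rewrite divr_ge0// ltW.
have C2s : 0 <= C2 / s by rewrite divr_ge0// ltW.
pose F' i := dist_fun (X n i); pose p i := F' i (mean_quantile F' tau).
have p01 i : 0 <= p i <= 1 by exact: dist_fun_itv.
have vE : s ^+ 2 = bvar p by rewrite s2 bvar_het_var.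
have [up1 _] := clt1 _ p s p01 s0 vE.
have [_ lo1] := clt2 _ p s p01 s0 vE.
have [bu bl] := studentized_df_bounds n0 (Hindep n n2) Fcont (Hpart n n2) (Hcard n n2)
  Fsame Htau v0 x d0 d5 Yeq.
rewrite -/v -/s -/u -/l -/F' -/p in bu bl.
rewrite /= -/(dist_fun (Y n) x).
by rewrite ler_norml; apply/andP; split; lra.
Qed.
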